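(* Let $\mathscr{Y}$ be a finite non-empty set, let $\overline{\mathrm{E}}'\colon\overline{\mathscr{L}}(\mathscr{Y})\to\overline{\mathbb{R}}$ be any map, and let $\overline{\mathrm{E}}$ be the restriction of $\overline{\mathrm{E}}'$ to $\mathscr{L}(\mathscr{Y})$. Then the following are equivalent: (i) $\overline{\mathrm{E}}'$ is an upper expectation on $\overline{\mathscr{L}}(\mathscr{Y})$ that satisfies $\overline{\mathrm{E}}'(f)=\lim_{c\to-\infty}\overline{\mathrm{E}}'(f^{\vee c})$ for all $f\in\overline{\mathscr{L}}(\mathscr{Y})$; (ii) $\overline{\mathrm{E}}$ is a coherent upper prevision and $\overline{\mathrm{E}}'=\overline{\mathrm{E}}_{\mathrm{ext}}$; (iii) $\overline{\mathrm{E}}$ is a coherent upper prevision, $\overline{\mathrm{E}}'(f)=\lim_{c\to-\infty}\overline{\mathrm{E}}'(f^{\vee c})$ for all $f\in\overline{\mathscr{L}}(\mathscr{Y})$, and $\overline{\mathrm{E}}'(f)=\lim_{c\to+\infty}\overline{\mathrm{E}}'(f^{\wedge c})$ for all $f\in\overline{\mathscr{L}}_b(\mathscr{Y})$.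
   Context: Notation: $\overline{\mathbb{R}}=\mathbb{R}\cup\{-\infty,+\infty\}$, with conventions $+\infty-\infty=-\infty+\infty=+\infty$ and $0\cdot(\pm\infty)=0$; $\mathbb{N}_0=\{0,1,2,\dots\}$. $\overline{\mathscr{L}}(\mathscr{Y})$ is the set of all maps $\mathscr{Y}\to\overline{\mathbb{R}}$, $\overline{\mathscr{L}}_b(\mathscr{Y})$ the subset of those bounded below by a real constant, and $\mathscr{L}(\mathscr{Y})$ the set of gambles, i.e. bounded real-valued maps on $\mathscr{Y}$. For $f\in\overline{\mathscr{L}}(\mathscr{Y})$ and $c\in\mathbb{R}$, $f^{\vee c}(y)=\max\{f(y),c\}$ and $f^{\wedge c}(y)=\min\{f(y),c\}$. Limits and inequalities of functions are pointwise. An upper expectation on $\overline{\mathscr{L}}(\mathscr{Y})$ is a map $\overline{\mathrm{E}}\colon\overline{\mathscr{L}}(\mathscr{Y})\to\overline{\mathbb{R}}$ such that: (E1) $\overline{\mathrm{E}}(c)=c$ for all $c\in\mathbb{R}$; (E2) $\overline{\mathrm{E}}(f+g)\le\overline{\mathrm{E}}(f)+\overline{\mathrm{E}}(g)$ for all $f,g\in\overline{\mathscr{L}}_b(\mathscr{Y})$; (E3) $\overline{\mathrm{E}}(\lambda f)=\lambda\overline{\mathrm{E}}(f)$ for all real $\lambda>0$ and $f\in\overline{\mathscr{L}}_b(\mathscr{Y})$; (E4) $f\le g\Rightarrow\overline{\mathrm{E}}(f)\le\overline{\mathrm{E}}(g)$ for all $f,g\in\overline{\mathscr{L}}_b(\mathscr{Y})$;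 (E5) $\lim_n\overline{\mathrm{E}}(f_n)=\overline{\mathrm{E}}(\lim_n f_n)$ for every non-decreasing sequence $\{f_n\}_{n\in\mathbb{N}_0}$ of non-negative variables in $\overline{\mathscr{L}}_b(\mathscr{Y})$. A coherent upper prevision on $\mathscr{L}(\mathscr{Y})$ is a real-valued map $\overline{\mathrm{E}}$ on $\mathscr{L}(\mathscr{Y})$ such that, for all $f,g\in\mathscr{L}(\mathscr{Y})$ and real $\lambda>0$: (C1) $\overline{\mathrm{E}}(f)\le\sup f$; (C2) $\overline{\mathrm{E}}(f+g)\le\overline{\mathrm{E}}(f)+\overline{\mathrm{E}}(g)$; (C3) $\overline{\mathrm{E}}(\lambda f)=\lambda\overline{\mathrm{E}}(f)$. For a coherent upper prevision $\overline{\mathrm{E}}$ on $\mathscr{L}(\mathscr{Y})$, define $\overline{\mathrm{E}}_{\uparrow}(f)=\lim_{c\to+\infty}\overline{\mathrm{E}}(f^{\wedge c})$ for $f\in\overline{\mathscr{L}}_b(\mathscr{Y})$, and then $\overline{\mathrm{E}}_{\mathrm{ext}}(f)=\lim_{c\to-\infty}\overline{\mathrm{E}}_{\uparrow}(f^{\vee c})$ for $f\in\overline{\mathscr{L}}(\mathscr{Y})$ (these limits exist by monotonicity). *)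

(* Defs.v *)
From mathcomp Require Export all_boot all_order all_algebra.
From mathcomp Require Export all_classical all_reals all_analysis.
Import Order.TTheory GRing.Theory Num.Theory.
Import numFieldNormedType.Exports.

Set Implicit Arguments.
Unset Strict Implicit.
Unset Printing Implicit Defensive.

Local Open Scope classical_set_scope.
Local Open Scope ring_scope.

Section UpperExpectations.
Context {R : realType} {Y : Type}.

Definition bounded_below (f : Y -> \bar R) := exists c : R, forall y, (c%:E <= f y)%E.

Definition gamble (f : Y -> R) := bounded_fun f.

Definition cut_below (f : Y -> \bar R) (c : R) : Y -> \bar R := fun y => maxe (f y) c%:E.

Definition cut_above (f : Y -> \bar R) (c : R) : Y -> \bar R := fun y => mine (f y) c%:E.

(* [dual_adde] is the addition with +oo - oo = -oo + oo = +oo; the default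
   addition of [\bar R] uses the opposite convention. *)
Record upper_expectation (E : (Y -> \bar R) -> \bar R) : Prop := {
  uexp_cst : forall c : R, E (cst c%:E) = c%:E ;
  uexp_subadditive : forall f g, bounded_below f -> bounded_below g ->
    (E (fun y => dual_adde (f y) (g y)) <= dual_adde (E f) (E g))%E ;
  uexp_homogeneous : forall (l : R) (f : Y -> \bar R), 0 < l -> bounded_below f ->
    E (fun y => l%:E * f y)%E = (l%:E * E f)%E ;
  uexp_monotone : forall f g, bounded_below f -> bounded_below g ->
    (forall y, (f y <= g y)%E) -> (E f <= E g)%E ;
  uexp_continuous : forall u : nat -> Y -> \bar R,
    (forall n, bounded_below (u n)) ->
    (forall n y, (0 <= u n y)%E) ->
    (forall n y, (u n y <= u n.+1 y)%E) ->
    E (u n) @[n --> \oo] --> E (fun y => limn (u ^~ y)) }.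

Definition continuous_cut_below (E : (Y -> \bar R) -> \bar R) :=
  forall f, E (cut_below f c) @[c --> -oo] --> E f.

Definition continuous_cut_above (E : (Y -> \bar R) -> \bar R) :=
  forall f, bounded_below f -> E (cut_above f c) @[c --> +oo] --> E f.

(* A functional on gambles is a map on all of [Y -> R] of which only the values
   at gambles are ever used; that those values are real is part of coherence,
   so that it can be asserted of the restriction of an arbitrary map. *)
Record coherent_upper_prevision (E : (Y -> R) -> \bar R) : Prop := {
  cup_real : forall f, gamble f -> E f \is a fin_num ;
  cup_sup : forall f, gamble f -> (E f <= (sup (range f))%:E)%E ;
  cup_subadditive : forall f g, gamble f -> gamble g ->
    (E (fun y => f y + g y)%R <= E f + E g)%E ;
  cup_homogeneous : forall (l : R) f, 0 < l -> gamble f ->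
    E (fun y => l * f y) = (l%:E * E f)%E }.

Definition restriction (E : (Y -> \bar R) -> \bar R) : (Y -> R) -> \bar R :=
  fun f => E (EFin \o f).

(* For [f] bounded below, [cut_above f c] is real-valued, and [fine] only turns
   it into a map to [R]. *)
Definition ext_up (E : (Y -> R) -> \bar R) (f : Y -> \bar R) : \bar R :=
  lim (E (fine \o cut_above f c) @[c --> +oo]).

Definition ext (E : (Y -> R) -> \bar R) (f : Y -> \bar R) : \bar R :=
  lim (ext_up E (cut_below f c) @[c --> -oo]).

End UpperExpectations.

(* Main.v *)
(* Coherence makes [E'] monotone on gambles, so for [f] bounded below the
   values [E' (cut_above f c)] increase with [c] and continuity along these
   cuts determines [E' f]; subadditivity, homogeneity and monotonicity then
   pass from gambles to functions bounded below.  Conversely an upper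
   expectation is continuous along upper cuts: shift [f] to be nonnegative and
   apply monotone convergence to its integer cuts.  On a finite set monotone
   convergence in turn comes for free from coherence, since truncations
   converge uniformly. *)
Require Import Defs.
From mathcomp Require Import lra.
Import Order.TTheory GRing.Theory Num.Theory.
Import numFieldNormedType.Exports.

Set Implicit Arguments.
Unset Strict Implicit.
Unset Printing Implicit Defensive.

Local Open Scope classical_set_scope.
Local Open Scope ring_scope.

(** * Extended reals: the two additions, and integer truncations *)

(** The two conventions differ only on sums of opposite infinities, which [+?] excludes. *)
Lemma dual_adde_addeE (R : realType) (x y : \bar R) : (x +? y)%E ->
  dual_adde x y = (x + y)%E.
Proof. exact: DualAddTheoryNumDomain.dual_addeE_def. Qed.

Lemma cvg_min_nat (R : realType) (x : \bar R) :
  mine x n%:R%:E @[n --> \oo] --> x.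
Proof.
case: x => [r||].
- apply: cvg_near_cst; near=> n; apply/min_idPl; rewrite lee_fin; near: n.
  exact: nbhs_infty_ger.
- by under eq_fun do rewrite minye; exact/cvgeryP/cvgr_idn.
- by under eq_fun do rewrite minNye; exact: cvg_cst.
Unshelve. all: by end_near. Qed.

(** * Bounded functions and their cuts *)

Section Cuts.
Context {R : realType} {Y : Type}.
Implicit Types (f g : Y -> \bar R) (c : R).

Definition bounded_above f := exists b : R, forall y, (f y <= b%:E)%E.

Lemma gambleP (f : Y -> R) :
  gamble f <-> bounded_below (EFin \o f) /\ bounded_above (EFin \o f).
Proof.
split=> [fbd|[[a af] [b fb]]].
  have [a af] := bounded_fun_has_lbound fbd.
  have [b fb] := bounded_fun_has_ubound fbd.
  by split; [exists a|exists b] => y /=; rewrite lee_fin; [apply: af|apply: fb];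
    exists y.
exists (Num.max `|a| `|b|); split; first exact: num_real.
move=> M ltM y _ /=; apply/ltW/(le_lt_trans _ ltM).
have := (af y, fb y); rewrite /= !lee_fin => -[afy fby].
rewrite ler_norml lerNl !le_max -(normrN a).
rewrite (le_trans _ (ler_norm (- a))) ?lerN2//.
by rewrite (le_trans fby (ler_norm b)) orbT.
Qed.

Lemma bounded_fin_num f y : bounded_below f -> bounded_above f ->
  f y \is a fin_num.
Proof.
move=> [a af] [b fb].
rewrite fin_real// (lt_le_trans (ltNyr a) (af y)).
by rewrite (le_lt_trans (fb y) (ltry b)).
Qed.

Lemma fineK_bounded f : bounded_below f -> bounded_above f ->
  EFin \o (fine \o f) = f.
Proof.
by move=> fl fu; apply/funext => y /=; rewrite fineK// bounded_fin_num.
Qed.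

Lemma bounded_below_cut_above f c : bounded_below f ->
  bounded_below (cut_above f c).
Proof.
move=> [m mf]; exists (Num.min m c) => y; rewrite /cut_above le_min.
by rewrite (le_trans _ (mf y))/= ?lee_fin ge_min lexx ?orbT.
Qed.

Lemma bounded_above_cut_above f c : bounded_above (cut_above f c).
Proof. by exists c => y; rewrite /cut_above ge_min lexx orbT. Qed.

Lemma bounded_below_cut_below f c : bounded_below (cut_below f c).
Proof. by exists c => y; rewrite /cut_below le_max lexx orbT. Qed.

Lemma bounded_below_le f g : bounded_below f -> (forall y, (f y <= g y)%E) ->
  bounded_below g.
Proof. by move=> [m mf] fg; exists m => y; rewrite (le_trans (mf y)). Qed.

Lemma le_cut_above f g c d : c <= d -> (forall y, (f y <= g y)%E) ->
  forall y, (cut_above f c y <= cut_above g d y)%E.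
Proof. by move=> cd fg y; rewrite /cut_above le_min2// lee_fin. Qed.

(** Cutting below a lower bound of [f] changes nothing, so the outer limit in [ext] is trivial when
    [f] is bounded below. *)
Lemma cut_below_near f : bounded_below f ->
  \forall c \near -oo, cut_below f c = f.
Proof.
move=> [m mf]; near=> c; apply/funext => y; apply/max_idPl.
rewrite (le_trans _ (mf y))// lee_fin; near: c.
by apply: nbhs_ninfty_le; rewrite num_real.
Unshelve. all: by end_near. Qed.

End Cuts.

(** * Limits along upper cuts for functionals monotone on bounded functions *)

Section MonotoneOnBounded.
Context {R : realType} {Y : Type} (E : (Y -> \bar R) -> \bar R).
Hypothesis E_monotone : forall f g, bounded_below f -> bounded_above g ->
  (forall y, (f y <= g y)%E) -> (E f <= E g)%E.

(** In [E_monotone] the inequality [f <= g] makes both functions bounded, so the hypothesis holds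
    for coherent previsions as well as for upper expectations. Cuts grow with their level, and
    monotone values converge to their supremum. *)
Lemma cvg_cut_above f : bounded_below f ->
  E (cut_above f c) @[c --> +oo] -->
    ereal_sup (range (fun c => E (cut_above f c))).
Proof.
move=> fb; apply: nondecreasing_cvge => c d cd; apply: E_monotone.
- exact: bounded_below_cut_above.
- exact: bounded_above_cut_above.
- exact: le_cut_above.
Qed.

(** Turns the [lim] in [ext_up] into an actual convergence; a cut is bounded on both sides, so
    [fine] loses nothing. *)
Lemma ext_up_cvg f : bounded_below f ->
  E (cut_above f c) @[c --> +oo] --> ext_up (restriction E) f.
Proof.
move=> fb; have h := cvg_cut_above fb.
rewrite /ext_up (_ : (fun c => _) = fun c => E (cut_above f c)); last first.
  apply/funext => c; rewrite /restriction fineK_bounded//.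
    exact: bounded_below_cut_above.
  exact: bounded_above_cut_above.
by rewrite (cvg_lim _ h)//; exact: ereal_hausdorff.
Qed.

End MonotoneOnBounded.

(** * Consequences of coherence for bounded functions *)

Section Coherent.
Context {R : realType} {Y : Type} (E : (Y -> \bar R) -> \bar R) (y0 : Y).
Hypothesis E_coherent : coherent_upper_prevision (restriction E).
Implicit Types f g : Y -> \bar R.

Lemma restriction_fine f : bounded_below f -> bounded_above f ->
  restriction E (fine \o f) = E f.
Proof. by move=> *; rewrite /restriction fineK_bounded. Qed.

Lemma gamble_fine f : bounded_below f -> bounded_above f ->
  gamble (fine \o f).
Proof. by move=> *; apply/gambleP; rewrite fineK_bounded. Qed.

Lemma coherent_fin_num f : bounded_below f -> bounded_above f ->
  E f \is a fin_num.
Proof.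
move=> fl fu; rewrite -restriction_fine//.
exact: (cup_real E_coherent) (gamble_fine fl fu).
Qed.

Lemma coherent_subadditive f g :
  bounded_below f -> bounded_above f -> bounded_below g -> bounded_above g ->
  (E (fun y => f y + g y) <= E f + E g)%E.
Proof.
move=> fl fu gl gu.
rewrite -(restriction_fine fl fu) -(restriction_fine gl gu).
have := cup_subadditive E_coherent (gamble_fine fl fu) (gamble_fine gl gu).
apply: le_trans; rewrite /restriction le_eqVlt; apply/orP; left; apply/eqP.
congr E; apply/funext => y /=.
by rewrite EFinD !fineK// bounded_fin_num.
Qed.

Lemma coherent_homogeneous (l : R) f :
  bounded_below f -> bounded_above f -> 0 < l ->
  E (fun y => l%:E * f y)%E = (l%:E * E f)%E.
Proof.
move=> fl fu l0; rewrite -(restriction_fine fl fu).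
rewrite -(cup_homogeneous E_coherent l0 (gamble_fine fl fu)) /restriction.
congr E; apply/funext => y /=.
by rewrite EFinM fineK// bounded_fin_num.
Qed.

Lemma coherent_le (b : R) f : bounded_below f -> (forall y, (f y <= b%:E)%E) ->
  (E f <= b%:E)%E.
Proof.
move=> fl fb; have fu : bounded_above f by exists b.
rewrite -restriction_fine//.
apply: le_trans (cup_sup E_coherent (gamble_fine fl fu)) _.
(* The point [y0] matters here: [sup] of an empty range would be the default value 0, which need not
   be below [b]. *)
rewrite lee_fin; apply: ge_sup; first by exists (fine (f y0)), y0.
move=> _ [y _ <-] /=; rewrite -lee_fin.
by rewrite fineK// bounded_fin_num.
Qed.

(** Write [f = (f - g) + g]; the first term is at most 0, hence so is its prevision, and
    subadditivity concludes. *)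
Lemma coherent_monotone f g : bounded_below f -> bounded_above g ->
  (forall y, (f y <= g y)%E) -> (E f <= E g)%E.
Proof.
move=> fl gu fg; have gl := bounded_below_le fl fg.
have fu : bounded_above f.
  by case: gu => b gb; exists b => y; exact: le_trans (gb y).
have ffin y := bounded_fin_num y fl fu.
have gfin y := bounded_fin_num y gl gu.
have dl : bounded_below (fun y => f y - g y)%E.
  have [[a af] [b gb]] := (fl, gu).
  by exists (a - b) => y; rewrite EFinB leeB.
have d0 y : (f y - g y <= 0%:E)%E by rewrite leeBlDr// add0e.
have -> : f = (fun y => (f y - g y) + g y)%E.
  by apply/funext => y; rewrite subeK.
apply: le_trans (coherent_subadditive dl _ gl gu) _; first by exists 0.
by rewrite -[leRHS]add0e leeD2r// coherent_le.
Qed.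

(** Homogeneity gives [E 0 = 2 * E 0], so [E 0 = 0] because the value is real. Then
    [0 <= E c + E (- c) <= E c - c] supplies the lower bound. *)
Lemma coherent_cst (c : R) : E (cst c%:E) = c%:E.
Proof.
have bl (d : R) : @bounded_below R Y (cst d%:E) by exists d.
have bu (d : R) : @bounded_above R Y (cst d%:E) by exists d.
have E0 : E (cst 0%:E) = 0%E.
  have := coherent_homogeneous (bl 0) (bu 0) (ltr0n R 2).
  rewrite (_ : (fun _ => _) = cst 0%:E); last first.
    by apply/funext => y; rewrite /= mule0.
  have := coherent_fin_num (bl 0) (bu 0); case: (E _) => // r _.
  by rewrite -EFinM => -[] h; congr EFin; lra.
apply/eqP; rewrite eq_le coherent_le//=.
have := coherent_subadditive (bl c) (bu c) (bl (- c)) (bu (- c)).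
rewrite (_ : (fun _ => _) = cst 0%:E); last first.
  by apply/funext => y; rewrite /= -EFinD subrr.
have : (E (cst (- c)%:E) <= (- c)%:E)%E by exact: coherent_le.
have := coherent_fin_num (bl c) (bu c).
have := coherent_fin_num (bl (- c)) (bu (- c)).
rewrite E0; case: (E (cst (- c)%:E)) => // r _; case: (E _) => // s _.
by rewrite -EFinD !lee_fin => *; lra.
Qed.

End Coherent.

(** * From gambles to functions bounded below, by continuity along upper cuts *)

Section CoherentContinuous.
Context {R : realType} {Y : Type} (E : (Y -> \bar R) -> \bar R) (y0 : Y).
Hypothesis E_coherent : coherent_upper_prevision (restriction E).
Hypothesis E_cut : continuous_cut_above E.
Implicit Types f g : Y -> \bar R.

Lemma cut_above_le f (c : R) : bounded_below f -> (E (cut_above f c) <= E f)%E.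
Proof.
move=> fl; apply: (cvge_ge _ (E_cut fl)); near=> d.
have cd : c <= d by near: d; apply: nbhs_pinfty_ge; rewrite num_real.
apply: (coherent_monotone y0 E_coherent).
- exact: bounded_below_cut_above.
- exact: bounded_above_cut_above.
- exact: le_cut_above.
Unshelve. all: by end_near. Qed.

(** Reduces an upper bound on [E f] to bounded functions. Only large [c] matter in the limit, so
    [0 <= c] may be assumed. *)
Lemma le_of_cut_above f x : bounded_below f ->
  (forall c, 0 <= c -> (E (cut_above f c) <= x)%E) -> (E f <= x)%E.
Proof.
move=> fl fx; apply: (cvge_le _ (E_cut fl)); near=> c; apply: fx; near: c.
by apply: nbhs_pinfty_ge; rewrite num_real.
Unshelve. all: by end_near. Qed.

Lemma coherent_continuous_monotone f g : bounded_below f ->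
  (forall y, (f y <= g y)%E) -> (E f <= E g)%E.
Proof.
move=> fl fg; have gl := bounded_below_le fl fg.
apply: le_of_cut_above => // c _.
apply: le_trans (cut_above_le c gl); apply: (coherent_monotone y0 E_coherent).
- exact: bounded_below_cut_above.
- exact: bounded_above_cut_above.
- exact: le_cut_above.
Qed.

(** Ensures that [E f + E g] never adds opposite infinities, so that the two additions agree on
    it. *)
Lemma coherent_continuous_gtNy f : bounded_below f -> (-oo < E f)%E.
Proof.
move=> [m mf]; rewrite (lt_le_trans (ltNyr m))//.
rewrite -[leLHS](coherent_cst y0 E_coherent).
by apply: coherent_continuous_monotone => //; exists m.
Qed.

Lemma coherent_continuous_subadditive f g :
  bounded_below f -> bounded_below g ->
  (E (fun y => dual_adde (f y) (g y)) <= dual_adde (E f) (E g))%E.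
Proof.
move=> fl gl.
rewrite dual_adde_addeE; last first.
  by rewrite ltninfty_adde_def// inE coherent_continuous_gtNy.
(* The common bound is nonpositive so that [m <= c - m] whenever [0 <= c]: cutting at [c - m] then
   preserves the lower bound [m]. *)
have [m m0 [mf mg]] : exists2 m : R, m <= 0 &
    (forall y, (m%:E <= f y)%E) /\ (forall y, (m%:E <= g y)%E).
  have [[a af] [b bg]] := (fl, gl).
  exists (Num.min 0 (Num.min a b)); first by rewrite ge_min lexx.
  by split=> y; [apply: le_trans (af y)|apply: le_trans (bg y)];
    rewrite lee_fin !ge_min lexx ?orbT.
rewrite (_ : (fun _ => _) = fun y => (f y + g y)%E); last first.
  apply/funext => y; rewrite dual_adde_addeE// ltninfty_adde_def// inE.
    exact: lt_le_trans (ltNyr m) (mf y).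
  exact: lt_le_trans (ltNyr m) (mg y).
have sl : bounded_below (fun y => f y + g y)%E.
  by exists (m + m) => y; rewrite EFinD leeD.
apply: le_of_cut_above => // c c0.
(* As [f] and [g] are at least [m <= 0], cutting both at [c - m] still leaves
   a sum that dominates [f + g] cut at [c]. *)
have [fcl fcu] := (bounded_below_cut_above (c - m) fl,
                   bounded_above_cut_above f (c - m)).
have [gcl gcu] := (bounded_below_cut_above (c - m) gl,
                   bounded_above_cut_above g (c - m)).
apply: le_trans (leeD (cut_above_le (c - m) fl) (cut_above_le (c - m) gl)).
apply: le_trans (coherent_subadditive E_coherent fcl fcu gcl gcu).
apply: coherent_continuous_monotone; first exact: bounded_below_cut_above.
move=> y; rewrite /cut_above.
have m_le (x : \bar R) : (m%:E <= x)%E -> (m%:E <= mine x (c - m)%:E)%E.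
  by move=> mx; rewrite le_min mx lee_fin; lra.
have cE : c%:E = (m%:E + (c - m)%:E)%E by rewrite -EFinD; congr EFin; lra.
(* If one summand exceeds [c - m], its cut equals [c - m] and the other cut is at least [m], so the
   sum is at least [c]; otherwise neither cut has any effect. *)
have [gc|gc] := leP (g y) (c - m)%:E; last first.
  by rewrite ge_min cE leeD2r ?orbT// m_le.
have [fc|fc] := leP (f y) (c - m)%:E; last first.
  by rewrite ge_min cE (addeC m%:E) leeD2l ?orbT.
by rewrite ge_min lexx.
Qed.

(** Cuts give one inequality for every positive factor; applying it to [l^-1] and [l * f] gives the
    reverse one. *)
Lemma coherent_continuous_homogeneous (l : R) f : 0 < l -> bounded_below f ->
  E (fun y => l%:E * f y)%E = (l%:E * E f)%E.
Proof.
have main (k : R) g : 0 < k -> bounded_below g ->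
    bounded_below (fun y => k%:E * g y)%E /\
    (E (fun y => k%:E * g y) <= k%:E * E g)%E.
  move=> k0 gl.
  have kgl : bounded_below (fun y => k%:E * g y)%E.
    by case: gl => m mg; exists (k * m) => y; rewrite EFinM lee_pmul2l.
  split=> //; apply: le_of_cut_above => // c _.
  have gcl := bounded_below_cut_above (c / k) gl.
  have gcu := bounded_above_cut_above g (c / k).
  have -> : cut_above (fun y => k%:E * g y)%E c =
            (fun y => k%:E * cut_above g (c / k) y)%E.
    apply/funext => y; rewrite /cut_above mine_pMr ?lee_fin ?ltW//.
    by rewrite -EFinM mulrCA divff ?mulr1// gt_eqF.
  by rewrite (coherent_homogeneous E_coherent)// lee_pmul2l// cut_above_le.
move=> l0 fl; apply/eqP; rewrite eq_le; have [lfl ->] := main l f l0 fl.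
have linv0 : 0 < l^-1 by rewrite invr_gt0.
have [_] := main _ _ linv0 lfl.
rewrite (_ : (fun _ => _) = f); last first.
  by apply/funext => y; rewrite muleA -EFinM mulVf ?gt_eqF// mul1e.
by rewrite -(@lee_pmul2l _ l%:E)// muleA -EFinM divff ?gt_eqF// mul1e.
Qed.

End CoherentContinuous.

(** * Monotone convergence on a finite set *)

(** Let [v] be the pointwise limit cut at [c]. By finiteness, one [n] satisfies [v - e <= u n] at
    all points, so [E v] exceeds the supremum of the [E (u n)] by at most [e]. *)
Lemma coherent_continuous_nondecreasing {R : realType} {Y : finType}
    (E : (Y -> \bar R) -> \bar R) (y0 : Y) (u : nat -> Y -> \bar R) :
  coherent_upper_prevision (restriction E) -> continuous_cut_above E ->
  (forall n, bounded_below (u n)) ->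
  (forall n y, (u n y <= u n.+1 y)%E) ->
  E (u n) @[n --> \oo] --> E (fun y => limn (u ^~ y)).
Proof.
move=> E_coh E_cut ul u_nd.
have u_homo y : {homo u ^~ y : n m / (n <= m)%N >-> (n <= m)%E}.
  by apply/nondecreasing_seqP => n; exact: u_nd.
have limE y : limn (u ^~ y) = ereal_sup (range (u ^~ y)).
  by apply/cvg_lim => //; exact: ereal_nondecreasing_cvgn.
have u_le n y : (u n y <= limn (u ^~ y))%E.
  by rewrite limE; apply: ereal_sup_ubound; exists n.
have Ehomo : {homo (fun n => E (u n)) : n m / (n <= m)%N >-> (n <= m)%E}.
  move=> n m nm; apply: (coherent_continuous_monotone y0) => // y.
  exact: u_homo.
have liml : bounded_below (fun y => limn (u ^~ y)).
  exact: bounded_below_le (ul 0%N) (u_le 0%N).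
rewrite (_ : E (fun y => _) = ereal_sup (range (fun n => E (u n)))).
  exact: ereal_nondecreasing_cvgn.
apply/eqP; rewrite eq_le; apply/andP; split; last first.
  apply: ge_ereal_sup => _ [n _ <-]; exact: (coherent_continuous_monotone y0).
apply: (le_of_cut_above E_cut) => // c c0; apply/lee_addgt0Pr => e e0.
set v := cut_above _ c.
have vl : bounded_below v by exact: bounded_below_cut_above.
have vu : bounded_above v by exact: bounded_above_cut_above.
have [n vn] : exists n, forall y, (v y - e%:E <= u n y)%E.
  have : \forall n \near \oo, forall y, (v y - e%:E <= u n y)%E.
    (* Finiteness of [Y] turns pointwise eventual bounds into a uniform one. *)
    apply: filter_forall => y.
    (* As [v y] is real, subtracting [e] falls strictly below the limit, even where the limit is
       [+oo]. *)
    have : (v y - e%:E < ereal_sup (range (u ^~ y)))%E.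
      rewrite -limE; apply: (@lt_le_trans _ _ (v y)).
        by rewrite lteBlDr// lteDl ?lte_fin// bounded_fin_num.
      by rewrite /v /cut_above ge_min lexx.
    move=> /ereal_sup_gt[_ [n _ <-] vn]; exists n => // m /= nm.
    exact: le_trans (ltW vn) (u_homo _ _ _ nm).
  by move=> [n _ h]; exists n; exact: (h n (leqnn n)).
have ucl := bounded_below_cut_above c (ul n).
have ucu := bounded_above_cut_above (u n) c.
apply: (@le_trans _ _ (E (cut_above (u n) c) + e%:E)%E); last first.
  apply: leeD => //.
  apply: le_trans (cut_above_le y0 E_coh E_cut c (ul n)) _.
  by apply: ereal_sup_ubound; exists n.
rewrite -(coherent_cst y0 E_coh e).
apply: (le_trans _ (coherent_subadditive E_coh ucl ucu _ _));
  [|by exists e|by exists e].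
apply: (coherent_continuous_monotone y0) => // y /=.
rewrite -leeBlDr// [leRHS]/cut_above le_min vn andTb leeBlDr//.
rewrite (@le_trans _ _ c%:E)//; first by rewrite /v /cut_above ge_min lexx orbT.
by rewrite leeDl// lee_fin ltW.
Qed.

(** * Coherence and upper-cut continuity of upper expectations *)

Section UpperExpectation.
Context {R : realType} {Y : Type} (E : (Y -> \bar R) -> \bar R).
Hypothesis E_uexp : upper_expectation E.
Implicit Types f g : Y -> \bar R.

(** Monotonicity squeezes [E f] between constants, which makes it real; comparison with the constant
    [sup f] gives the bound by the supremum. *)
Lemma uexp_coherent : coherent_upper_prevision (restriction E).
Proof.
have bl (d : R) : @bounded_below R Y (cst d%:E) by exists d.
have rfin (f : Y -> R) : gamble f -> restriction E f \is a fin_num.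
  move=> /gambleP[fl [b fb]]; have [a af] := fl; rewrite fin_real//.
  apply/andP; split.
    rewrite (lt_le_trans (ltNyr a))// -[leLHS](uexp_cst E_uexp).
    exact: (uexp_monotone E_uexp).
  rewrite (le_lt_trans _ (ltry b))// -[leRHS](uexp_cst E_uexp).
  exact: (uexp_monotone E_uexp).
split=> // [f fg|f g fg gg|l f l0 fg].
- have /gambleP[fl fu] := fg.
  rewrite -[leRHS](uexp_cst E_uexp); apply: (uexp_monotone E_uexp) => // y /=.
  rewrite lee_fin; apply: ub_le_sup; last by exists y.
  exact: bounded_fun_has_ubound.
- have /gambleP[fl fu] := fg; have /gambleP[gl gu] := gg.
  have := uexp_subadditive E_uexp fl gl.
  by rewrite [leRHS]dual_adde_addeE// fin_num_adde_defr// rfin.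
- have /gambleP[fl fu] := fg.
  by rewrite -(uexp_homogeneous E_uexp l0 fl).
Qed.

Lemma uexp_shift f (c : R) : bounded_below f ->
  (E (fun y => f y + c%:E) <= E f + c%:E)%E.
Proof.
move=> fl; have := uexp_subadditive E_uexp fl (_ : bounded_below (cst c%:E)).
rewrite (uexp_cst E_uexp) dual_adde_addeE ?fin_num_adde_defl//.
rewrite (_ : (fun _ => _) = fun y => (f y + c%:E)%E); last first.
  by apply/funext => y; rewrite dual_adde_addeE ?fin_num_adde_defl.
by apply; exists c.
Qed.

Lemma uexp_continuous_cut_above : continuous_cut_above E.
Proof.
move=> f fl; have [m mf] := fl.
have Emono f1 f2 : bounded_below f1 -> (forall y, (f1 y <= f2 y)%E) ->
    (E f1 <= E f2)%E.
  move=> fl1 fle; apply: (uexp_monotone E_uexp) => //.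
  exact: bounded_below_le fl1 fle.
set L := ereal_sup (range (fun c => E (cut_above f c))).
rewrite (_ : E f = L).
  by apply: cvg_cut_above => // f1 f2 fl1 _; exact: Emono.
apply/eqP; rewrite eq_le; apply/andP; split; last first.
  apply: ge_ereal_sup => _ [c _ <-]; apply: Emono.
    exact: bounded_below_cut_above.
  by move=> y; rewrite /cut_above ge_min lexx.
(* Monotone convergence is available for nonnegative functions only, hence the shift by the lower
   bound [m]. *)
pose g y := (f y - m%:E)%E.
have g0 y : (0 <= g y)%E by rewrite /g sube_ge0.
have gl : bounded_below g by exists 0.
have -> : f = (fun y => g y + m%:E)%E by apply/funext => y; rewrite subeK.
apply: le_trans (uexp_shift m gl) _; rewrite -leeBrDr//.
have := uexp_continuous E_uexp (u := fun n => cut_above g n%:R).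
rewrite (_ : (fun _ => limn _) = g); last first.
  by apply/funext => y; apply/cvg_lim => //; exact: cvg_min_nat.
have gnl n : bounded_below (cut_above g n%:R).
  exact: bounded_below_cut_above.
move=> /(_ gnl) Eg; apply: (cvge_le _ (Eg _ _)).
- apply: nearW => n.
  apply: (@le_trans _ _ (E (cut_above f (n%:R + m)) - m%:E)%E).
    (* Cutting [f - m] at [n] is cutting [f] at [n + m] and then subtracting [m]. *)
    have -> : cut_above g n%:R =
        (fun y => cut_above f (n%:R + m) y + (- m)%:E)%E.
      apply/funext => y; rewrite /cut_above /g; have [h|h] := leP (f y) _.
        by apply/min_idPl; rewrite leeBlDr.
      by rewrite -EFinD addrK; apply/min_idPr; rewrite leeBrDr// ltW.
    exact/uexp_shift/bounded_below_cut_above.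
  by rewrite leeD2r//; apply: ereal_sup_ubound; exists (n%:R + m).
- by move=> n y; rewrite /cut_above le_min g0 lee_fin/=.
- by move=> n y; apply: le_cut_above => //; rewrite ler_nat.
Qed.

End UpperExpectation.

(** * The cycle of implications between the three characterisations *)

Theorem proposition10 (R : realType) (Y : finType) (Y_nonempty : (0 < #|Y|)%N)
    (E' : (Y -> \bar R) -> \bar R) :
  [<-> upper_expectation E' /\ continuous_cut_below E';
       coherent_upper_prevision (restriction E') /\
         E' = ext (restriction E');
       [/\ coherent_upper_prevision (restriction E'),
           continuous_cut_below E' & continuous_cut_above E']].
Proof.
have /card_gt0P[y0 _] := Y_nonempty.
have ext_upE : coherent_upper_prevision (restriction E') ->
    continuous_cut_above E' ->
    forall f, bounded_below f -> ext_up (restriction E') f = E' f.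
  move=> coh cut f fl.
  have := ext_up_cvg (coherent_monotone y0 coh) fl.
  by move/cvg_unique; apply; [exact: ereal_hausdorff|exact: cut].
tfae.
- move=> [uexp below]; have coh := uexp_coherent uexp.
  split=> //; apply/funext => f; rewrite /ext.
  under eq_fun => c.
    rewrite ext_upE; first over.
    - exact: coh.
    - exact: uexp_continuous_cut_above.
    - exact: bounded_below_cut_below.
  by apply/esym/cvg_lim; [exact: ereal_hausdorff|exact: below].
- move=> [coh Eext].
  (* The lower cuts of [f] are eventually [f] itself, so the outer limit of [ext] is that of an
     eventually constant function. *)
  have ext_up_eq f : bounded_below f -> E' f = ext_up (restriction E') f.
    move=> fl; rewrite [in LHS]Eext /ext.
    apply: lim_near_cst; first exact: ereal_hausdorff.
    by apply: filterS (cut_below_near fl) => c ->.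
  have above : continuous_cut_above E'.
    move=> f fl; have := ext_up_cvg (coherent_monotone y0 coh) fl.
    by rewrite -ext_up_eq.
  split=> // f.
  (* The equation [E' = ext] speaks of [lim], which by itself asserts no convergence; monotonicity
     supplies it. The sign change moves the limit to [+oo], where the values decrease to their
     infimum. *)
  have cvg_below : E' (cut_below f c) @[c --> -oo] -->
      ereal_inf (range (fun c => E' (cut_below f (- c)))).
    apply/cvgNy_compNP; apply: nonincreasing_cvge => c d cd /=.
    apply: (coherent_continuous_monotone y0 coh above).
      exact: bounded_below_cut_below.
    by move=> y; rewrite /cut_below le_max2// lee_fin lerN2.
  suff -> : E' f = ereal_inf (range (fun c => E' (cut_below f (- c)))) by [].
  rewrite -(cvg_lim (@ereal_hausdorff R) cvg_below) [in LHS]Eext /ext.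
  under eq_fun => c.
    rewrite -ext_up_eq; first over.
    exact: bounded_below_cut_below.
  by [].
- move=> [coh below above]; split=> //; split.
  + exact: coherent_cst.
  + exact: coherent_continuous_subadditive.
  + by move=> l f; exact: coherent_continuous_homogeneous.
  + by move=> f g fl _; exact: (coherent_continuous_monotone y0).
  + by move=> u ul _; exact: (coherent_continuous_nondecreasing y0).
Qed.
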